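(* Let $d\ge 5$ be an integer with $d\equiv 1\pmod 4$, put $d'=\lfloor d/4\rfloor$, let $k$ be a rational and $\varepsilon$ a positive real such that $$2\le k<2+\frac{1}{2d'-1}\qquad\text{and}\qquad \varepsilon k\sum_{j=0}^{d'-1}(k-1)^{2j}\ \ge\ 1.$$ If $G$ is a fractionally $k$-colorable graph and $W\subseteq V(G)$ is a set of vertices at pairwise distance at least $d$, then every fractional $(k+\varepsilon)$-precoloring of $W$ extends to a fractional $(k+\varepsilon)$-coloring of $G$.
   Context: A fractional $m$-coloring of a graph (real $m>0$) assigns to each vertex a measurable subset of $[0,m)$ of Lebesgue measure one so that adjacent vertices receive disjoint sets; a graph is fractionally $k$-colorable if it has a fractional $k$-coloring. A fractional $m$-precoloring of a vertex set $W$ assigns measurable subsets of $[0,m)$ of measure one to the vertices of $W$; it extends if some fractional $m$-coloring of the whole graph agrees with it on $W$. Graphs are finite. *)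

(* Defs.v *)
From Stdlib Require Import Reals QArith Qreals List.
Open Scope R_scope.
Set Implicit Arguments.
Unset Strict Implicit.

Definition interval_cover_sum (A : R -> Prop) (s : R) : Prop :=
  exists a b : nat -> R,
    (forall n, a n <= b n) /\
    (forall x, A x -> exists n, a n <= x < b n) /\
    infinite_sum (fun n => b n - a n) s.

Definition outer_measure_is (A : R -> Prop) (r : R) : Prop :=
  (forall s, interval_cover_sum A s -> r <= s) /\
  (forall r', (forall s, interval_cover_sum A s -> r' <= s) -> r' <= r).

(* Caratheodory measurability.  Test sets of infinite outer measure satisfy
   the criterion trivially, so it suffices to test sets with finite outer
   measure. *)
Definition lebesgue_measurable (A : R -> Prop) : Prop :=
  forall (E : R -> Prop) (r : R), outer_measure_is E r ->
    exists r1 r2,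
      outer_measure_is (fun x => E x /\ A x) r1 /\
      outer_measure_is (fun x => E x /\ ~ A x) r2 /\
      r = r1 + r2.

Definition unit_color_set (m : R) (A : R -> Prop) : Prop :=
  (forall x, A x -> 0 <= x < m) /\
  lebesgue_measurable A /\
  outer_measure_is A 1.

Definition finite_simple_graph (V : Type) (adj : V -> V -> Prop) : Prop :=
  (exists l : list V, forall v, In v l) /\
  (forall u v, adj u v -> adj v u) /\
  (forall v, ~ adj v v).

Definition fractional_coloring (V : Type) (adj : V -> V -> Prop) (m : R)
  (c : V -> R -> Prop) : Prop :=
  (forall v, unit_color_set m (c v)) /\
  (forall u v, adj u v -> forall x, ~ (c u x /\ c v x)).

Definition fractionally_colorable (V : Type) (adj : V -> V -> Prop) (m : R) : Prop :=
  exists c, fractional_coloring adj m c.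

Definition fractional_precoloring (V : Type) (W : V -> Prop) (m : R)
  (p : V -> R -> Prop) : Prop :=
  forall v, W v -> unit_color_set m (p v).

Definition precoloring_extends (V : Type) (adj : V -> V -> Prop) (W : V -> Prop)
  (m : R) (p : V -> R -> Prop) : Prop :=
  exists c, fractional_coloring adj m c /\
    (forall v, W v -> forall x, c v x <-> p v x).

Inductive walk (V : Type) (adj : V -> V -> Prop) : V -> V -> nat -> Prop :=
| walk0 : forall v, walk adj v v 0
| walkS : forall u w v n, adj u w -> walk adj w v n -> walk adj u v (S n).

Definition pairwise_distance_at_least (V : Type) (adj : V -> V -> Prop)
  (W : V -> Prop) (d : nat) : Prop :=
  forall u v, W u -> W v -> u <> v -> forall n, walk adj u v n -> (d <= n)%nat.

(* Main.v *)
Require Import Defs.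
From Stdlib Require Import Reals QArith Qreals List Lra Lia Arith.
From Stdlib Require Import Classical ClassicalEpsilon IndefiniteDescription.
From Stdlib Require Import FunctionalExtensionality PropExtensionality.
Open Scope R_scope.

(** Transport the base coloring to sets [y v] in [[0, k + eps)], keeping
disjointness, so that each [y v] has measure [(k + eps) / k] and meets every
precolored set [p w] in measure [1 / k].  Vertices far from [W] use subsets of
their [y v].  Since [k < 2 + 1 / (2 d' - 1)] bounds the odd girth from below, the layers
at distance less than [2 d'] from a vertex [w] of [W] are independent, so the
transition from [p w] to the sets [y v] only has to respect consecutive layers:
even layers gradually abandon [p w], odd layers its complement [Q].  If the even
layers at distance [2 i] have released measure [a i] of [p w] and
[(k - 1) a i] of [Q], they have exactly measure one, and the odd layers have
measure at least one iff [(k - 1)^2 a (i+1) <= a i + (k - 1)^2 - 1 + k eps].  This recursion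
leads from [a 0 = 0] to [a d' = 1] precisely when
[eps k (1 + (k - 1)^2 + ... + (k - 1)^(2 (d' - 1))) >= 1]. *)

(** * Outer measure and measurability *)

Definition inter (A B : R -> Prop) : R -> Prop := fun x => A x /\ B x.
Definition diff (A B : R -> Prop) : R -> Prop := fun x => A x /\ ~ B x.
Definition union (A B : R -> Prop) : R -> Prop := fun x => A x \/ B x.
Definition empty : R -> Prop := fun _ => False.
Definition below (t : R) : R -> Prop := fun x => 0 <= x < t.

Lemma set_ext (A B : R -> Prop) : (forall x, A x <-> B x) -> A = B.
Proof.
  intros H; apply functional_extensionality; intros x.
  apply propositional_extensionality, H.
Qed.

Ltac set_tac :=
  unfold inter, diff, union, empty in *; intros;
  repeat match goal with H : forall y : R, _ , x : R |- _ => specialize (H x) end; tauto.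

Lemma partial_sum_le (f : nat -> R) (s : R) (n : nat) :
  (forall i, 0 <= f i) -> infinite_sum f s -> sum_f_R0 f n <= s.
Proof.
  intros Hf Hs. apply (sum_incr f n s).
  - intros e He. destruct (Hs e He) as [N HN]. exists N. exact HN.
  - exact Hf.
Qed.

Lemma bounded_sum_converges (f : nat -> R) (s : R) :
  (forall i, 0 <= f i) -> (forall n, sum_f_R0 f n <= s) ->
  exists t, t <= s /\ infinite_sum f t.
Proof.
  intros Hf Hs.
  assert (Hg : Un_growing (sum_f_R0 f)).
  { intros n. simpl. specialize (Hf (S n)). lra. }
  destruct (growing_cv _ Hg) as [t Ht].
  { exists s. intros x [n ->]. apply Hs. }
  exists t. split.
  - destruct (Rle_lt_dec t s) as [H|H]; [exact H|].
    destruct (Ht (t - s)) as [N HN]; [lra|].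
    specialize (HN N (le_n N)). unfold Rdist in HN.
    specialize (Hs N). rewrite Rabs_left1 in HN; lra.
  - intros e He. destruct (Ht e He) as [N HN]. exists N. exact HN.
Qed.

Lemma cover_sum_nonneg (A : R -> Prop) (s : R) : interval_cover_sum A s -> 0 <= s.
Proof.
  intros (a & b & Hab & _ & Hs).
  assert (Hp : forall i, 0 <= b i - a i) by (intros i; specialize (Hab i); lra).
  pose proof (partial_sum_le _ _ 0 Hp Hs) as H. simpl in H. specialize (Hp 0%nat). lra.
Qed.

Lemma cover_sum_subset (A B : R -> Prop) (s : R) :
  (forall x, A x -> B x) -> interval_cover_sum B s -> interval_cover_sum A s.
Proof.
  intros H (a & b & Hab & Hc & Hs). exists a, b. split; [exact Hab|split; auto].
Qed.

Lemma outer_measure_exists (A : R -> Prop) (s : R) :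
  interval_cover_sum A s -> exists r, outer_measure_is A r.
Proof.
  intros Hs.
  destruct (completeness (fun x => interval_cover_sum A (- x))) as [m [Hu Hl]].
  - exists 0. intros x Hx. apply cover_sum_nonneg in Hx. lra.
  - exists (- s). rewrite Ropp_involutive. exact Hs.
  - exists (- m). split.
    + intros t Ht. assert (H : - t <= m); [|lra].
      apply Hu. rewrite Ropp_involutive. exact Ht.
    + intros r Hr. assert (H : m <= - r); [|lra].
      apply Hl. intros x Hx. specialize (Hr _ Hx). lra.
Qed.

Lemma outer_measure_unique (A : R -> Prop) (r r' : R) :
  outer_measure_is A r -> outer_measure_is A r' -> r = r'.
Proof. intros [H1 H2] [H3 H4]. apply Rle_antisym; auto. Qed.

Lemma outer_measure_approx (A : R -> Prop) (r e : R) :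
  outer_measure_is A r -> 0 < e -> exists s, s < r + e /\ interval_cover_sum A s.
Proof.
  intros [H1 H2] He. apply NNPP. intros Hn.
  assert (H : r + e <= r); [|lra].
  apply H2. intros s Hs. destruct (Rle_lt_dec (r + e) s); [assumption|].
  exfalso; apply Hn; eauto.
Qed.

Lemma outer_measure_nonneg (A : R -> Prop) (r : R) : outer_measure_is A r -> 0 <= r.
Proof. intros [_ H]. apply H. intros s. apply cover_sum_nonneg. Qed.

Lemma outer_measure_subset (A B : R -> Prop) (r : R) :
  (forall x, A x -> B x) -> outer_measure_is B r ->
  exists r', outer_measure_is A r' /\ r' <= r.
Proof.
  intros HAB HB.
  destruct (outer_measure_approx B r 1 HB) as (s & _ & Hs); [lra|].
  destruct (outer_measure_exists A s) as [r' Hr'];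
    [exact (cover_sum_subset A B s HAB Hs)|].
  exists r'. split; [exact Hr'|]. apply HB. intros t Ht.
  apply Hr'. exact (cover_sum_subset A B t HAB Ht).
Qed.

Definition interleave (f g : nat -> R) (n : nat) : R :=
  if Nat.even n then f (Nat.div2 n) else g (Nat.div2 n).

Lemma interleave_even (f g : nat -> R) (n : nat) : interleave f g (2 * n) = f n.
Proof.
  unfold interleave. rewrite Nat.even_mul. simpl orb. cbv iota.
  rewrite Nat.div2_double. reflexivity.
Qed.

Lemma interleave_odd (f g : nat -> R) (n : nat) : interleave f g (S (2 * n)) = g n.
Proof.
  unfold interleave. rewrite Nat.even_succ, Nat.odd_mul. simpl andb. cbv iota.
  rewrite Nat.div2_succ_double. reflexivity.
Qed.

Lemma sum_interleave (f g : nat -> R) (n : nat) :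
  sum_f_R0 (interleave f g) (S (2 * n)) = sum_f_R0 f n + sum_f_R0 g n.
Proof.
  induction n as [|n IH].
  - simpl. unfold interleave; simpl. ring.
  - replace (S (2 * S n)) with (S (S (S (2 * n)))) by lia.
    rewrite tech5, (tech5 _ (S (2 * n))), IH.
    replace (S (S (2 * n))) with (2 * S n)%nat by lia.
    rewrite interleave_even, interleave_odd. simpl. ring.
Qed.

(** The two covers are interleaved. Only an upper bound on the new total is claimed, so boundedness
    of the partial sums is enough for convergence. *)
Lemma cover_sum_union (A B : R -> Prop) (s t : R) :
  interval_cover_sum A s -> interval_cover_sum B t ->
  exists u, u <= s + t /\ interval_cover_sum (union A B) u.
Proof.
  intros (a & b & Hab & Hc & Hs) (a' & b' & Hab' & Hc' & Hs').
  assert (E : forall n, interleave b b' n - interleave a a' n =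
                interleave (fun i => b i - a i) (fun i => b' i - a' i) n).
  { intros n. unfold interleave. destruct (Nat.even n); reflexivity. }
  assert (Hp : forall n, 0 <= interleave b b' n - interleave a a' n).
  { intros n. unfold interleave. destruct (Nat.even n);
    [specialize (Hab (Nat.div2 n))|specialize (Hab' (Nat.div2 n))]; lra. }
  assert (Hp1 : forall n, 0 <= b n - a n) by (intros n; specialize (Hab n); lra).
  assert (Hp2 : forall n, 0 <= b' n - a' n) by (intros n; specialize (Hab' n); lra).
  destruct (bounded_sum_converges
              (fun n => interleave b b' n - interleave a a' n) (s + t) Hp)
    as [u [Hu1 Hu2]].
  { intros n.
    (* The sum is extended to the odd index [2 * n + 1], where each cover has contributed exactly
       its first [n + 1] terms. *)
    assert (Hle : sum_f_R0 (fun n => interleave b b' n - interleave a a' n) n <=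
                  sum_f_R0 (fun n => interleave b b' n - interleave a a' n) (S (2 * n))).
    { destruct (Nat.eq_dec n (S (2 * n))) as [e|e]; [lia|].
      rewrite (tech2 _ n (S (2 * n))) by lia.
      pose proof (cond_pos_sum
        (fun i => interleave b b' (S n + i)%nat - interleave a a' (S n + i)%nat)
        (S (2 * n) - S n) (fun i => Hp (S n + i)%nat)). lra. }
    refine (Rle_trans _ _ _ Hle _).
    rewrite (sum_eq _ _ (S (2 * n)) (fun i _ => E i)), sum_interleave.
    apply Rplus_le_compat; apply partial_sum_le; assumption. }
  exists u. split; [exact Hu1|].
  exists (interleave a a'), (interleave b b'). split; [|split; [|exact Hu2]].
  - intros n. specialize (Hp n). lra.
  - intros x [Hx|Hx].
    + destruct (Hc x Hx) as [n Hn]. exists (2 * n)%nat. rewrite !interleave_even. exact Hn.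
    + destruct (Hc' x Hx) as [n Hn]. exists (S (2 * n))%nat. rewrite !interleave_odd. exact Hn.
Qed.

Lemma outer_measure_subadd (A B C : R -> Prop) (r s t : R) :
  (forall x, C x -> A x \/ B x) ->
  outer_measure_is A r -> outer_measure_is B s -> outer_measure_is C t -> t <= r + s.
Proof.
  intros H HA HB HC. apply le_epsilon. intros e He.
  destruct (outer_measure_approx A r (e / 2) HA) as (u & Hu & Hu'); [lra|].
  destruct (outer_measure_approx B s (e / 2) HB) as (v & Hv & Hv'); [lra|].
  destruct (cover_sum_union A B u v Hu' Hv') as (z & Hz & Hz').
  assert (t <= z) by (apply HC; exact (cover_sum_subset C (union A B) z H Hz')). lra.
Qed.

(** * Caratheodory measurable sets *)

Lemma measurable_compl (A : R -> Prop) :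
  lebesgue_measurable A -> lebesgue_measurable (fun x => ~ A x).
Proof.
  intros HA E r HE. destruct (HA E r HE) as (r1 & r2 & H1 & H2 & H3).
  exists r2, r1. split; [exact H2|split; [|lra]].
  replace (fun x => E x /\ ~ ~ A x) with (fun x => E x /\ A x); [exact H1|].
  apply set_ext. intros x. tauto.
Qed.

Lemma measurable_inter (A B : R -> Prop) :
  lebesgue_measurable A -> lebesgue_measurable B -> lebesgue_measurable (inter A B).
Proof.
  intros HA HB E r HE.
  destruct (HA E r HE) as (r1 & r2 & H1 & H2 & H3).
  destruct (HB _ _ H1) as (r11 & r12 & H11 & H12 & H13).
  destruct (outer_measure_subset (fun x => E x /\ ~ inter A B x) E r) as (z & Hz & Hzr);
    [tauto|exact HE|].
  exists r11, z.
  assert (H11' : outer_measure_is (fun x => E x /\ inter A B x) r11).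
  { replace (fun x => E x /\ inter A B x) with (fun x => (E x /\ A x) /\ B x);
    [exact H11|]. apply set_ext. unfold inter. tauto. }
  split; [exact H11'|split; [exact Hz|]].
  assert (z <= r12 + r2).
  { apply (outer_measure_subadd _ _ _ r12 r2 z) with (2 := H12) (3 := H2) (4 := Hz).
    unfold inter. intros x. tauto. }
  assert (r <= r11 + z).
  { apply (outer_measure_subadd _ _ _ r11 z r) with (2 := H11') (3 := Hz) (4 := HE).
    intros x. tauto. }
  lra.
Qed.

(** Each interval of a cover is cut at [t]. The left and right pieces cover the two parts of [E],
    and their lengths add up to the old length. *)
Lemma measurable_below (t : R) : lebesgue_measurable (fun x => x < t).
Proof.
  intros E r HE.
  destruct (outer_measure_subset (fun x => E x /\ x < t) E r) as (r1 & H1 & _);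
    [tauto|exact HE|].
  destruct (outer_measure_subset (fun x => E x /\ ~ x < t) E r) as (r2 & H2 & _);
    [tauto|exact HE|].
  exists r1, r2. split; [exact H1|split; [exact H2|]].
  apply Rle_antisym.
  { apply (outer_measure_subadd _ _ _ r1 r2 r) with (2 := H1) (3 := H2) (4 := HE).
    intros x. tauto. }
  apply HE. intros s (a & b & Hab & Hc & Hs).
  assert (Hp : forall i, 0 <= b i - a i) by (intros i; specialize (Hab i); lra).
  set (f := fun n => Rmin (b n) t - Rmin (a n) t).
  set (g := fun n => Rmax (b n) t - Rmax (a n) t).
  assert (Hf : forall n, 0 <= f n).
  { intros n. unfold f, Rmin. specialize (Hab n). repeat destruct Rle_dec; lra. }
  assert (Hg : forall n, 0 <= g n).
  { intros n. unfold g, Rmax. specialize (Hab n). repeat destruct Rle_dec; lra. }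
  assert (Hfg : forall n, f n + g n = b n - a n).
  { intros n. unfold f, g, Rmin, Rmax. repeat destruct Rle_dec; lra. }
  assert (Hsum : forall n, sum_f_R0 f n + sum_f_R0 g n <= s).
  { intros n. rewrite <- plus_sum. rewrite (sum_eq _ (fun n => b n - a n)) by auto.
    apply partial_sum_le; auto. }
  destruct (bounded_sum_converges f s Hf) as (u & Hu & Hu').
  { intros n. specialize (Hsum n). pose proof (cond_pos_sum g n Hg). lra. }
  (* Were a partial sum of [g] above [s - u], a late partial sum of [f], close to its limit [u],
     would push the total above [s]. *)
  destruct (bounded_sum_converges g (s - u) Hg) as (v & Hv & Hv').
  { intros n. assert (u <= s - sum_f_R0 g n); [|lra].
    apply Rnot_lt_le. intros Hlt.
    destruct (Hu' (u - (s - sum_f_R0 g n))) as [N HN]; [lra|].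
    specialize (HN (Nat.max N n) (Nat.le_max_l _ _)). unfold Rdist in HN.
    apply Rabs_def2 in HN. specialize (Hsum (Nat.max N n)).
    assert (sum_f_R0 g n <= sum_f_R0 g (Nat.max N n)); [|lra].
    destruct (Nat.eq_dec n (Nat.max N n)) as [e|e]; [rewrite <- e; lra|].
    rewrite (tech2 g n (Nat.max N n)) by lia.
    pose proof (cond_pos_sum (fun i => g (S n + i)%nat) (Nat.max N n - S n)
                  (fun i => Hg (S n + i)%nat)). lra. }
  assert (r1 <= u).
  { apply H1. exists (fun n => Rmin (a n) t), (fun n => Rmin (b n) t).
    split; [|split; [|exact Hu']].
    - intros n. specialize (Hf n). unfold f in Hf. lra.
    - intros x [Hx Hxt]. destruct (Hc x Hx) as [n Hn]. exists n.
      unfold Rmin; repeat destruct Rle_dec; lra. }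
  assert (r2 <= v).
  { apply H2. exists (fun n => Rmax (a n) t), (fun n => Rmax (b n) t).
    split; [|split; [|exact Hv']].
    - intros n. specialize (Hg n). unfold g in Hg. lra.
    - intros x [Hx Hxt]. destruct (Hc x Hx) as [n Hn]. exists n.
      unfold Rmax; repeat destruct Rle_dec; lra. }
  lra.
Qed.

Lemma measurable_half_open (t : R) : lebesgue_measurable (below t).
Proof.
  replace (below t) with (inter (fun x => ~ x < 0) (fun x => x < t)).
  - apply measurable_inter; [apply measurable_compl|]; apply measurable_below.
  - apply set_ext. unfold inter, below. intros x. split; intros; lra.
Qed.

(** * Outer measure of an interval *)

Lemma single_interval_sum (l : R) : infinite_sum (fun n => if Nat.eqb n 0 then l else 0) l.
Proof.
  intros e He. exists 0%nat. intros n _.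
  assert (H : sum_f_R0 (fun n => if Nat.eqb n 0 then l else 0) n = l).
  { induction n as [|n IH]; [reflexivity|]. rewrite tech5, IH. simpl. ring. }
  rewrite H. unfold Rdist. rewrite Rminus_diag, Rabs_R0. exact He.
Qed.

Lemma interval_cover (s t : R) : s <= t -> interval_cover_sum (fun x => s <= x < t) (t - s).
Proof.
  intros Hst.
  exists (fun n => if Nat.eqb n 0 then s else 0), (fun n => if Nat.eqb n 0 then t else 0).
  split; [|split].
  - intros n. destruct (Nat.eqb n 0); lra.
  - intros x Hx. exists 0%nat. exact Hx.
  - replace (fun n => (if Nat.eqb n 0 then t else 0) - (if Nat.eqb n 0 then s else 0))
      with (fun n => if Nat.eqb n 0 then t - s else 0); [apply single_interval_sum|].
    apply functional_extensionality. intros n. destruct (Nat.eqb n 0); lra.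
Qed.

Lemma geometric_half_sum (e : R) (n : nat) :
  0 < e -> sum_f_R0 (fun i => e * (/ 2) ^ (S i)) n <= e.
Proof.
  intros He.
  assert (H : sum_f_R0 (fun i => e * (/ 2) ^ (S i)) n = e - e * (/ 2) ^ (S n)).
  { induction n as [|n IH]; [simpl; field|]. rewrite tech5, IH. simpl. field. }
  rewrite H. assert (0 < (/ 2) ^ (S n)) by (apply pow_lt; lra). nra.
Qed.

(* Compactness is replaced by a supremum argument: [len t i] is the length to the
   left of [t] of the [i]-th interval, enlarged at its left end, and the supremum
   of the [t] bounded by some partial sum of [len t] cannot be below [m]. *)
Lemma cover_sum_below_ge (m s : R) : 0 <= m -> interval_cover_sum (below m) s -> m <= s.
Proof.
  intros Hm (a & b & Hab & Hc & Hs). apply le_epsilon. intros e He.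
  assert (Hp : forall i, 0 <= b i - a i) by (intros i; specialize (Hab i); lra).
  set (a' := fun n => a n - e * (/ 2) ^ (S n)).
  set (len := fun t n => Rmax 0 (Rmin (b n) t - a' n)).
  assert (Hd : forall n, 0 < e * (/ 2) ^ (S n)).
  { intros n. apply Rmult_lt_0_compat; [lra|apply pow_lt; lra]. }
  assert (Hlen0 : forall t n, 0 <= len t n) by (intros t n; apply Rmax_l).
  assert (Hbound : forall t N, sum_f_R0 (len t) N <= s + e).
  { intros t N.
    apply Rle_trans with (sum_f_R0 (fun n => (b n - a n) + e * (/ 2) ^ (S n)) N).
    - apply sum_Rle. intros n _. unfold len, a'. specialize (Hab n). specialize (Hd n).
      unfold Rmax, Rmin. repeat destruct Rle_dec; lra.
    - rewrite plus_sum. apply Rplus_le_compat;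
        [apply partial_sum_le; assumption|apply geometric_half_sum; exact He]. }
  set (T := fun t => 0 <= t <= m /\ exists N, t <= sum_f_R0 (len t) N).
  destruct (completeness T) as [t0 [Hub Hlub]].
  { exists m. intros t [[_ Ht] _]. exact Ht. }
  { exists 0. split; [lra|]. exists 0%nat. simpl. apply Hlen0. }
  assert (Ht0 : 0 <= t0).
  { apply Hub. split; [lra|]. exists 0%nat. simpl. apply Hlen0. }
  assert (Ht0m : t0 <= m) by (apply Hlub; intros t [[_ Ht] _]; exact Ht).
  destruct (Rlt_le_dec t0 m) as [Hlt|Hge].
  - exfalso. destruct (Hc t0) as [n [Hn1 Hn2]]; [split; lra|].
    (* Here the enlargement matters: [t0] lies strictly to the right of [a' n] even when [t0 = a n],
       so some member of [T] does too. *)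
    assert (Hex : exists t, T t /\ a' n < t).
    { apply NNPP. intros Hno. assert (t0 <= a' n).
      - apply Hlub. intros t Ht. apply Rnot_lt_le. intros Hl. apply Hno; eauto.
      - unfold a' in H. specialize (Hd n). lra. }
    destruct Hex as (t & [[Ht1 Ht2] [N HN]] & Hat).
    assert (Htt0 : t <= t0) by (apply Hub; split; [lra|eauto]).
    set (t' := Rmin (b n) m).
    assert (Ht' : t0 < t' <= b n /\ t' <= m).
    { unfold t', Rmin. destruct Rle_dec; lra. }
    assert (Hin : T t'); [|specialize (Hub t' Hin); lra].
    split; [lra|]. exists (N + S n)%nat.
    assert (Hinc : forall i, len t i <= len t' i).
    { intros i. unfold len. apply Rle_max_compat_l. unfold Rmin.
      repeat destruct Rle_dec; lra. }
    assert (Hmono : forall q, sum_f_R0 (len t) N <= sum_f_R0 (len t) (N + q)).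
    { intros q. induction q as [|q IHq]; [rewrite Nat.add_0_r; lra|].
      rewrite Nat.add_succ_r, tech5. specialize (Hlen0 t (S (N + q))). lra. }
    assert (Hjump : forall M, (n <= M)%nat ->
              sum_f_R0 (len t) M + (t' - t) <= sum_f_R0 (len t') M).
    { assert (Hn : len t' n = len t n + (t' - t)).
      { unfold len, Rmax, Rmin. repeat destruct Rle_dec; lra. }
      intros M HM. induction HM as [|M HM IH].
      - destruct n as [|n']; [simpl; lra|]. rewrite !tech5.
        pose proof (sum_Rle (len t) (len t') n' (fun i _ => Hinc i)). lra.
      - rewrite !tech5. specialize (Hinc (S M)). lra. }
    specialize (Hjump (N + S n)%nat ltac:(lia)). specialize (Hmono (S n)). lra.
  - replace m with t0 by lra.
    apply Hlub. intros t [_ [N HN]]. specialize (Hbound t N). lra.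
Qed.

Lemma outer_measure_below (m : R) : 0 <= m -> outer_measure_is (below m) m.
Proof.
  intros Hm. split.
  - intros s. apply cover_sum_below_ge. exact Hm.
  - intros r Hr. apply Hr. replace m with (m - 0) at 2 by ring.
    apply interval_cover. exact Hm.
Qed.

(** * A finitely additive divisible measure *)

Definition bounded_measurable (A : R -> Prop) : Prop :=
  lebesgue_measurable A /\ exists M, forall x, A x -> 0 <= x < M.

(** A total choice of the outer measure, arbitrary where none exists; sets in [bounded_measurable]
    always have one. *)
Definition measure (A : R -> Prop) : R := epsilon (inhabits 0) (outer_measure_is A).

Lemma measure_eq (A : R -> Prop) (r : R) : outer_measure_is A r -> measure A = r.
Proof.
  intros H. apply (outer_measure_unique A); [|exact H].
  unfold measure. apply epsilon_spec. eauto.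
Qed.

Lemma measureP (A : R -> Prop) : bounded_measurable A -> outer_measure_is A (measure A).
Proof.
  intros [_ [M HM]]. unfold measure. apply epsilon_spec.
  destruct (outer_measure_subset A (below (Rmax 0 M)) (Rmax 0 M)) as (r & Hr & _).
  - intros x Hx. specialize (HM x Hx). split; [lra|].
    apply Rlt_le_trans with M; [lra|apply Rmax_r].
  - apply outer_measure_below, Rmax_l.
  - eauto.
Qed.

Lemma measure_nonneg (A : R -> Prop) : bounded_measurable A -> 0 <= measure A.
Proof. intros H. apply (outer_measure_nonneg A), measureP, H. Qed.

Lemma measure_subset (A B : R -> Prop) :
  bounded_measurable A -> bounded_measurable B -> (forall x, A x -> B x) ->
  measure A <= measure B.
Proof.
  intros HA HB HAB.
  destruct (outer_measure_subset A B (measure B) HAB (measureP B HB)) as (r & Hr & Hle).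
  rewrite (measure_eq A r Hr). exact Hle.
Qed.

Lemma bm_inter (A B : R -> Prop) :
  bounded_measurable A -> bounded_measurable B -> bounded_measurable (inter A B).
Proof.
  intros [HA [M HM]] [HB _]. split; [apply measurable_inter; assumption|].
  exists M. intros x [Hx _]. auto.
Qed.

Lemma bm_diff (A B : R -> Prop) :
  bounded_measurable A -> bounded_measurable B -> bounded_measurable (diff A B).
Proof.
  intros [HA [M HM]] [HB _]. split.
  - exact (measurable_inter A (fun x => ~ B x) HA (measurable_compl B HB)).
  - exists M. intros x [Hx _]. auto.
Qed.

Lemma bm_union (A B : R -> Prop) :
  bounded_measurable A -> bounded_measurable B -> bounded_measurable (union A B).
Proof.
  intros [HA [M HM]] [HB [N HN]]. split.
  - replace (union A B) with (fun x => ~ inter (fun y => ~ A y) (fun y => ~ B y) x).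
    + apply measurable_compl, measurable_inter; apply measurable_compl; assumption.
    + apply set_ext. unfold inter, union. intros x. tauto.
  - exists (Rmax M N). intros x [Hx|Hx].
    + specialize (HM x Hx). split; [lra|]. apply Rlt_le_trans with M; [lra|apply Rmax_l].
    + specialize (HN x Hx). split; [lra|]. apply Rlt_le_trans with N; [lra|apply Rmax_r].
Qed.

Lemma bm_below (t : R) : bounded_measurable (below t).
Proof. split; [apply measurable_half_open|]. exists t. unfold below. auto. Qed.

Lemma measure_below (t : R) : 0 <= t -> measure (below t) = t.
Proof. intros Ht. apply measure_eq, outer_measure_below, Ht. Qed.

Lemma below_zero : below 0 = empty.
Proof. apply set_ext. unfold below, empty. intros x. split; [lra|tauto]. Qed.

Lemma bm_empty : bounded_measurable empty.
Proof. rewrite <- below_zero. apply bm_below. Qed.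

Lemma measure_empty : measure empty = 0.
Proof. rewrite <- below_zero. apply measure_below. lra. Qed.

Lemma measure_split (A B : R -> Prop) :
  bounded_measurable A -> bounded_measurable B ->
  measure A = measure (inter A B) + measure (diff A B).
Proof.
  intros HA [HB _].
  destruct (HB A (measure A) (measureP A HA)) as (r1 & r2 & H1 & H2 & H3).
  rewrite H3. f_equal; symmetry; apply measure_eq; assumption.
Qed.

Lemma measure_union (A B : R -> Prop) :
  bounded_measurable A -> bounded_measurable B -> (forall x, ~ (A x /\ B x)) ->
  measure (union A B) = measure A + measure B.
Proof.
  intros HA HB HAB. rewrite (measure_split (union A B) A (bm_union A B HA HB) HA).
  f_equal; f_equal; apply set_ext; set_tac.
Qed.

Lemma measure_subadd (A B : R -> Prop) :
  bounded_measurable A -> bounded_measurable B ->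
  measure (union A B) <= measure A + measure B.
Proof.
  intros HA HB.
  apply (outer_measure_subadd A B (union A B)); [auto| | |];
    apply measureP; auto using bm_union.
Qed.

Lemma measure_diff (A B : R -> Prop) :
  bounded_measurable A -> bounded_measurable B -> (forall x, B x -> A x) ->
  measure (diff A B) = measure A - measure B.
Proof.
  intros HA HB HBA. rewrite (measure_split A B HA HB).
  replace (inter A B) with B; [ring|]. apply set_ext. set_tac.
Qed.

Lemma measure_below_lipschitz (A : R -> Prop) (s t : R) :
  bounded_measurable A -> s <= t ->
  0 <= measure (inter A (below t)) - measure (inter A (below s)) <= t - s.
Proof.
  intros HA Hst.
  assert (Hs := bm_inter A (below s) HA (bm_below s)).
  assert (Ht := bm_inter A (below t) HA (bm_below t)).
  assert (Hsub : forall x, inter A (below s) x -> inter A (below t) x).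
  { unfold inter, below. intros x [H1 H2]. split; [exact H1|lra]. }
  rewrite <- (measure_diff _ _ Ht Hs Hsub). split.
  - apply measure_nonneg, bm_diff; assumption.
  - apply (measureP _ (bm_diff _ _ Ht Hs)).
    apply cover_sum_subset with (fun x => s <= x < t); [|apply interval_cover; exact Hst].
    unfold diff, inter, below. intros x [[H1 H2] H3]. split; [|lra].
    apply Rnot_lt_le. intros Hl. apply H3. split; [exact H1|lra].
Qed.

(** The measure of [A] to the left of [t] is 1-Lipschitz in [t], so the intermediate value theorem
    applies. *)
Lemma measure_divisible (A : R -> Prop) (s : R) :
  bounded_measurable A -> 0 <= s <= measure A ->
  exists t, measure (inter A (below t)) = s.
Proof.
  intros HA [Hs0 Hs1].
  destruct HA as [HAm [M HM]]. assert (HA : bounded_measurable A) by (split; eauto).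
  set (f := fun t => measure (inter A (below t)) - s).
  set (N := Rmax 1 M).
  assert (HN : 1 <= N) by apply Rmax_l.
  assert (HMN : M <= N) by apply Rmax_r.
  assert (Hcont : continuity f).
  { intros t e He. exists e. split; [exact He|]. intros x [_ Hx].
    simpl in *. unfold Rdist in *. unfold f.
    apply Rle_lt_trans with (2 := Hx).
    destruct (Rle_lt_dec t x) as [H|H].
    - pose proof (measure_below_lipschitz A t x HA H).
      rewrite (Rabs_pos_eq (x - t)) by lra. apply Rabs_le. lra.
    - pose proof (measure_below_lipschitz A x t HA (Rlt_le _ _ H)).
      rewrite (Rabs_left (x - t)) by lra. apply Rabs_le. lra. }
  assert (Hf0 : f 0 = - s).
  { unfold f. rewrite below_zero. replace (inter A empty) with empty.
    - rewrite measure_empty. ring.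
    - apply set_ext. set_tac. }
  assert (HfN : f N = measure A - s).
  { unfold f. replace (inter A (below N)) with A; [reflexivity|].
    apply set_ext. unfold inter, below. intros x. split; [|tauto].
    intros Hx. specialize (HM x Hx). split; [exact Hx|lra]. }
  (* [IVT] asks for a strict sign change, so the two extreme values of [s] are treated apart. *)
  destruct (Req_dec s 0) as [->|Hs]; [exists 0; unfold f in Hf0; lra|].
  destruct (Req_dec s (measure A)) as [Hs'|Hs']; [exists N; unfold f in HfN; lra|].
  destruct (IVT f 0 N Hcont) as [t [_ Ht]]; [lra|lra|lra|].
  exists t. unfold f in Ht. lra.
Qed.

Lemma measure_parts (B1 B2 C : R -> Prop) :
  bounded_measurable B1 -> bounded_measurable B2 -> bounded_measurable C ->
  (forall x, ~ (B1 x /\ B2 x)) ->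
  measure (inter (union B1 B2) C) = measure (inter B1 C) + measure (inter B2 C).
Proof.
  intros H1 H2 HC H12.
  rewrite <- measure_union; auto using bm_inter; [|set_tac].
  f_equal. apply set_ext. set_tac.
Qed.

(** * Splitting sets uniformly *)

(** Relative to [A], the set [B] has probability [l] and is independent of every test. *)
Definition uniform_in (A : R -> Prop) (tests : list (R -> Prop)) (l : R)
  (B : R -> Prop) : Prop :=
  bounded_measurable B /\ (forall x, B x -> A x) /\ measure B = l * measure A /\
  forall C, In C tests -> measure (inter B C) = l * measure (inter A C).

(** Induction on the tests: [A] is split along the first test, each half gets a family for the
    remaining tests, and the two families are united at equal parameter. The union meets the first
    test exactly in the inner family, so that proportion is right as well. *)
Lemma uniform_family_exists (tests : list (R -> Prop)) :
  (forall C, In C tests -> bounded_measurable C) ->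
  forall A, bounded_measurable A ->
  exists B : R -> R -> Prop,
    (forall l, 0 <= l <= 1 -> uniform_in A tests l (B l)) /\
    (forall l l', 0 <= l <= l' -> l' <= 1 -> forall x, B l x -> B l' x).
Proof.
  induction tests as [|C0 tests IH]; intros Ht A HA.
  (* On a null set the measure cannot force the cut points to increase with [l], so the constant
     family is used. *)
  - destruct (Req_dec (measure A) 0) as [H0|H0].
    + exists (fun _ => A). split; [|auto]. intros l Hl. unfold uniform_in.
      split; [exact HA|split; [auto|split; [rewrite H0; ring|]]]. simpl. tauto.
    + pose proof (measure_nonneg A HA) as Hn.
      assert (Htau : exists tau : R -> R, forall l, 0 <= l <= 1 ->
                measure (inter A (below (tau l))) = l * measure A).
      { exists (fun l => epsilon (inhabits 0)
                  (fun t => measure (inter A (below t)) = l * measure A)).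
        intros l Hl. apply epsilon_spec. apply measure_divisible; [exact HA|nra]. }
      destruct Htau as [tau Htau].
      exists (fun l => inter A (below (tau l))). split.
      * intros l Hl. unfold uniform_in. split; [apply bm_inter; auto using bm_below|].
        split; [unfold inter; tauto|]. split; [auto|]. simpl. tauto.
      * intros l l' Hl Hl' x. destruct (Req_dec l l') as [<-|Hne]; [tauto|].
        assert (Hlt : tau l < tau l').
        { apply Rnot_le_lt. intros Hle.
          pose proof (measure_below_lipschitz A _ _ HA Hle) as Hm.
          rewrite !Htau in Hm by lra. assert (l < l') by lra. nra. }
        unfold inter, below. intros [Hx1 Hx2]. split; [exact Hx1|lra].
  - assert (HC0 : bounded_measurable C0) by (apply Ht; left; reflexivity).
    assert (Ht' : forall C, In C tests -> bounded_measurable C) by (intros; apply Ht; right; auto).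
    destruct (IH Ht' (inter A C0) (bm_inter _ _ HA HC0)) as (B1 & H1 & M1).
    destruct (IH Ht' (diff A C0) (bm_diff _ _ HA HC0)) as (B2 & H2 & M2).
    exists (fun l => union (B1 l) (B2 l)). split.
    + intros l Hl. destruct (H1 l Hl) as (a1 & b1 & c1 & d1).
      destruct (H2 l Hl) as (a2 & b2 & c2 & d2).
      assert (Hdis : forall x, ~ (B1 l x /\ B2 l x)).
      { intros x [Hx1 Hx2]. apply b1 in Hx1. apply b2 in Hx2.
        unfold inter, diff in *. tauto. }
      split; [apply bm_union; assumption|]. split; [|split].
      * intros x [Hx|Hx]; [apply b1 in Hx; apply Hx|apply b2 in Hx; apply Hx].
      * rewrite measure_union by assumption.
        rewrite (measure_split A C0 HA HC0). rewrite c1, c2. ring.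
      * intros C [<-|HC].
        -- replace (inter (union (B1 l) (B2 l)) C0) with (B1 l); [exact c1|].
           apply set_ext. intros x. specialize (b1 x). specialize (b2 x).
           unfold inter, union, diff in *. tauto.
        -- rewrite measure_parts; auto.
           rewrite d1, d2 by exact HC.
           rewrite <- Rmult_plus_distr_l, <- measure_parts; auto using bm_inter, bm_diff.
           ++ f_equal. f_equal. apply set_ext. unfold inter, union, diff.
              intros x. destruct (classic (C0 x)); tauto.
           ++ set_tac.
    + intros l l' Hl Hl' x [Hx|Hx]; [left; apply (M1 l)|right; apply (M2 l)]; auto.
Qed.

(** The end members are made exactly empty and exactly [A], not merely up to null sets, because
    agreement with the precoloring and disjointness are pointwise conditions. *)
Lemma uniform_chain_exists (tests : list (R -> Prop)) (A : R -> Prop) :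
  (forall C, In C tests -> bounded_measurable C) -> bounded_measurable A ->
  exists B : R -> R -> Prop,
    (forall l, 0 <= l <= 1 -> uniform_in A tests l (B l)) /\
    (forall l l', 0 <= l <= l' -> l' <= 1 -> forall x, B l x -> B l' x) /\
    (forall x, ~ B 0 x) /\ (forall x, A x -> B 1 x).
Proof.
  intros Ht HA. destruct (uniform_family_exists tests Ht A HA) as (B & HB & HM).
  exists (fun l x => A x /\ 0 < l /\ (B l x \/ 1 <= l)). split; [|split; [|split]].
  - intros l Hl. destruct (Req_dec l 0) as [->|H0]; [|destruct (Req_dec l 1) as [->|H1]].
    + replace (fun x => A x /\ 0 < 0 /\ (B 0 x \/ 1 <= 0)) with empty.
      * split; [apply bm_empty|split; [set_tac|split]].
        -- rewrite measure_empty. ring.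
        -- intros C _. replace (inter empty C) with empty;
             [rewrite measure_empty; ring|apply set_ext; set_tac].
      * apply set_ext. unfold empty. intros x. split; [tauto|]. intros [_ [H _]]; lra.
    + replace (fun x => A x /\ 0 < 1 /\ (B 1 x \/ 1 <= 1)) with A.
      * split; [exact HA|split; [auto|split; [ring|]]]. intros; ring.
      * apply set_ext. intros x. split; [|tauto]. intros Hx.
        split; [exact Hx|split; [lra|right; lra]].
    + replace (fun x => A x /\ 0 < l /\ (B l x \/ 1 <= l)) with (B l); [apply HB; exact Hl|].
      apply set_ext. intros x. split.
      * intros Hx. split; [apply (HB l Hl); exact Hx|split; [lra|auto]].
      * intros (_ & _ & [Hx|Hx]); [exact Hx|lra].
  - intros l l' Hl Hl' x (Hx & Hpos & Hor). split; [exact Hx|split; [lra|]].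
    destruct Hor as [Hx'|H1]; [left; apply (HM l l'); assumption|right; lra].
  - intros x (_ & H & _). lra.
  - intros x Hx. split; [exact Hx|split; [lra|right; lra]].
Qed.

Lemma subset_of_measure (A : R -> Prop) (s : R) :
  bounded_measurable A -> 0 <= s <= measure A ->
  exists B, bounded_measurable B /\ (forall x, B x -> A x) /\ measure B = s.
Proof.
  intros HA Hs. destruct (measure_divisible A s HA Hs) as [t Ht].
  exists (inter A (below t)). split; [apply bm_inter; auto using bm_below|].
  split; [unfold inter; tauto|exact Ht].
Qed.

(** The proportions are stated as products so that zero masses are allowed. A zero mass yields a
    literally empty part, which is what makes transported sets pointwise disjoint. *)
Lemma proportional_split (tests : list (R -> Prop)) (A : R -> Prop) (m1 m2 : R) :
  (forall C, In C tests -> bounded_measurable C) -> bounded_measurable A ->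
  0 <= m1 -> 0 <= m2 ->
  exists A1 A2,
    bounded_measurable A1 /\ bounded_measurable A2 /\
    (forall x, A1 x -> A x) /\ (forall x, A2 x -> A x) /\
    (forall x, ~ (A1 x /\ A2 x)) /\
    (m1 = 0 -> A1 = empty) /\ (m2 = 0 -> A2 = empty) /\
    forall C, In C tests ->
      measure (inter A1 C) * (m1 + m2) = m1 * measure (inter A C) /\
      measure (inter A2 C) * (m1 + m2) = m2 * measure (inter A C).
Proof.
  intros Ht HA H1 H2.
  assert (He : forall C, measure (inter empty C) = 0).
  { intros C. replace (inter empty C) with empty; [apply measure_empty|].
    apply set_ext; set_tac. }
  destruct (Req_dec m1 0) as [->|N1].
  { destruct (Req_dec m2 0) as [->|N2]; [exists empty, empty|exists empty, A];
      pose proof bm_empty; repeat (split; [first [assumption|tauto|set_tac]|]);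
      intros; rewrite ?He; split; ring. }
  destruct (Req_dec m2 0) as [->|N2].
  { exists A, empty; pose proof bm_empty; repeat (split; [first [assumption|tauto|set_tac]|]);
      intros; rewrite ?He; split; ring. }
  destruct (uniform_family_exists tests Ht A HA) as (B & HB & _).
  set (l := m1 / (m1 + m2)).
  assert (Hl : l * (m1 + m2) = m1) by (unfold l; field; lra).
  assert (Hl01 : 0 <= l <= 1).
  { assert (0 < m1) by lra. assert (0 < m2) by lra. split; nra. }
  destruct (HB l Hl01) as (b1 & b2 & _ & b4).
  exists (B l), (diff A (B l)). split; [exact b1|split; [apply bm_diff; assumption|]].
  split; [exact b2|split; [unfold diff; tauto|split; [unfold diff; tauto|]]].
  split; [tauto|split; [tauto|]]. intros C HC. specialize (b4 C HC).
  assert (E : measure (inter A C) = measure (inter (B l) C) + measure (inter (diff A (B l)) C)).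
  { rewrite <- measure_parts; auto using bm_diff; [|unfold diff; tauto].
    f_equal. f_equal. apply set_ext. intros x. specialize (b2 x).
    unfold union, diff. destruct (classic (B l x)); tauto. }
  assert (E1 : measure (inter (B l) C) * (m1 + m2) = m1 * measure (inter A C)).
  { rewrite b4. transitivity (l * (m1 + m2) * measure (inter A C)); [ring|].
    rewrite Hl. reflexivity. }
  split; [exact E1|]. rewrite E, Rmult_plus_distr_l in E1. rewrite E. lra.
Qed.

(* A measure-theoretic transport of the Boolean algebra generated by the sets
   [c v] from [D] into [A], stochastically independent of the sets in [tests]. *)
Lemma transport_exists (V : Type) (c : V -> R -> Prop) (tests : list (R -> Prop)) :
  (forall v, bounded_measurable (c v)) ->
  (forall C, In C tests -> bounded_measurable C) ->
  forall (vs : list V) (D A : R -> Prop), bounded_measurable D -> bounded_measurable A ->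
  exists y : V -> R -> Prop,
    (forall v, In v vs -> bounded_measurable (y v) /\ (forall x, y v x -> A x) /\
       forall C, In C tests ->
         measure (inter (y v) C) * measure D =
         measure (inter D (c v)) * measure (inter A C)) /\
    (forall u v, In u vs -> In v vs ->
       (forall x, ~ (D x /\ c u x /\ c v x)) -> forall x, ~ (y u x /\ y v x)).
Proof.
  intros Hc Ht vs. induction vs as [|v0 vs IH]; intros D A HD HA.
  { exists (fun _ => empty). simpl. tauto. }
  assert (HD1 : bounded_measurable (inter D (c v0))) by auto using bm_inter.
  assert (HD2 : bounded_measurable (diff D (c v0))) by auto using bm_diff.
  pose proof (measure_split D (c v0) HD (Hc v0)) as HDs.
  (* [A] is divided in the ratio of the parts of [D] inside and outside [c v0]. The vertex [v0]
     receives the first part, and the remaining sets are transported into both parts separately. *)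
  destruct (proportional_split tests A (measure (inter D (c v0))) (measure (diff D (c v0))) Ht HA
              (measure_nonneg _ HD1) (measure_nonneg _ HD2))
    as (A1 & A2 & HA1 & HA2 & S1 & S2 & Hdis & Z1 & Z2 & Hprop).
  rewrite <- HDs in Hprop.
  destruct (IH _ A1 HD1 HA1) as (y1 & Y1 & X1).
  destruct (IH _ A2 HD2 HA2) as (y2 & Y2 & X2).
  assert (Hy : exists y : V -> R -> Prop,
             y v0 = A1 /\ forall v, v <> v0 -> y v = union (y1 v) (y2 v)).
  { exists (fun v x => (v = v0 /\ A1 x) \/ (v <> v0 /\ (y1 v x \/ y2 v x))).
    split; [|intros v Hv]; apply set_ext; unfold union; tauto. }
  destruct Hy as (y & E0 & E1). exists y.
  split.
  - intros v Hv. destruct (classic (v = v0)) as [->|Hne].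
    + rewrite E0. split; [exact HA1|split; [exact S1|]]. intros C HC. apply Hprop, HC.
    + rewrite E1 by exact Hne. destruct Hv as [Hv|Hv]; [congruence|].
      destruct (Y1 v Hv) as (a1 & b1 & c1). destruct (Y2 v Hv) as (a2 & b2 & c2).
      split; [apply bm_union; assumption|]. split.
      { intros x [Hx|Hx]; auto. }
      intros C HC. destruct (Hprop C HC) as [P1 P2].
      specialize (c1 C HC). specialize (c2 C HC).
      rewrite measure_parts; auto; [|intros x [Hx1 Hx2]; apply (Hdis x); auto].
      assert (Es : measure (inter D (c v)) = measure (inter (inter D (c v0)) (c v)) +
                                             measure (inter (diff D (c v0)) (c v))).
      { rewrite <- measure_parts; auto; [|set_tac].
        f_equal. apply set_ext. intros x. unfold inter, union, diff.
        destruct (classic (c v0 x)); tauto. }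
      assert (He : forall Y : R -> Prop, (forall x, Y x -> empty x) -> measure (inter Y C) = 0).
      { intros Y HY. replace (inter Y C) with empty; [apply measure_empty|].
        apply set_ext. set_tac. }
      (* Chains the proportion within a half with the proportion of that half in the whole,
         cancelling the measure [m'] of the half of [D]. *)
      assert (key : forall m m' q q' t, m' <> 0 -> q * m' = t * q' ->
                q' * measure D = m' * m -> q * measure D = t * m).
      { intros m m' q q' t Hm' Hq Hq'. apply (Rmult_eq_reg_r m'); [|exact Hm'].
        replace (q * measure D * m') with ((q * m') * measure D) by ring.
        rewrite Hq. replace (t * q' * measure D) with (t * (q' * measure D)) by ring.
        rewrite Hq'. ring. }
      assert (zero : forall X, bounded_measurable X -> measure X = 0 -> measure (inter X (c v)) = 0).
      { intros X HX H0. apply Rle_antisym; [|apply measure_nonneg; auto using bm_inter].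
        rewrite <- H0. apply measure_subset; auto using bm_inter. unfold inter; tauto. }
      rewrite Es, !Rmult_plus_distr_r. f_equal.
      (* If this half of [D] is null, nothing can be cancelled, but its part of [A] is empty and
         both sides vanish. *)
      * destruct (Req_dec (measure (inter D (c v0))) 0) as [H0|H0].
        -- rewrite (zero _ HD1 H0), He; [ring|]. intros x Hx. rewrite <- (Z1 H0). auto.
        -- exact (key _ _ _ _ _ H0 c1 P1).
      * destruct (Req_dec (measure (diff D (c v0))) 0) as [H0|H0].
        -- rewrite (zero _ HD2 H0), He; [ring|]. intros x Hx. rewrite <- (Z2 H0). auto.
        -- exact (key _ _ _ _ _ H0 c2 P2).
  - assert (half : forall v, In v vs -> v <> v0 ->
      (forall x, ~ (D x /\ c v0 x /\ c v x)) -> forall x, ~ (A1 x /\ union (y1 v) (y2 v) x)).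
    { intros v Hv Hne Hd x [Hx [Hy|Hy]].
      (* The pair [v], [v] is used: [c v] misses [inter D (c v0)], so [y1 v] is disjoint from
         itself, hence empty. *)
      - apply (X1 v v Hv Hv) with (x := x); [|tauto]. unfold inter. intros z. specialize (Hd z). tauto.
      - apply (Hdis x). split; [exact Hx|]. apply (Y2 v Hv). exact Hy. }
    intros u v Hu Hv Hd.
    destruct (classic (u = v0)) as [->|Hnu]; destruct (classic (v = v0)) as [->|Hnv].
    + rewrite E0. intros x [Hx _]. rewrite Z1 in Hx; [exact Hx|].
      replace (inter D (c v0)) with empty; [apply measure_empty|].
      apply set_ext. intros z. specialize (Hd z). unfold empty, inter. tauto.
    + rewrite E0, E1 by exact Hnv. destruct Hv as [Hv|Hv]; [congruence|]. auto.
    + rewrite E0, E1 by exact Hnu. destruct Hu as [Hu|Hu]; [congruence|].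
      intros x Hx. apply (half u Hu Hnu) with (x := x); [|tauto].
      intros z. specialize (Hd z). tauto.
    + rewrite !E1 by assumption. destruct Hu as [Hu|Hu]; [congruence|].
      destruct Hv as [Hv|Hv]; [congruence|].
      destruct (Y1 u Hu) as (_ & su1 & _). destruct (Y2 u Hu) as (_ & su2 & _).
      destruct (Y1 v Hv) as (_ & sv1 & _). destruct (Y2 v Hv) as (_ & sv2 & _).
      intros x. specialize (su1 x). specialize (su2 x). specialize (sv1 x). specialize (sv2 x).
      specialize (Hdis x).
      assert (D1 : ~ (y1 u x /\ y1 v x)).
      { apply X1; auto. intros z. specialize (Hd z). unfold inter. tauto. }
      assert (D2 : ~ (y2 u x /\ y2 v x)).
      { apply X2; auto. intros z. specialize (Hd z). unfold diff. tauto. }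
      unfold union. tauto.
Qed.

Lemma unit_color_setP (m : R) (A : R -> Prop) :
  unit_color_set m A <->
  (forall x, A x -> below m x) /\ bounded_measurable A /\ measure A = 1.
Proof.
  split.
  - intros (H1 & H2 & H3). split; [exact H1|split; [|apply measure_eq; exact H3]].
    split; [exact H2|exists m; exact H1].
  - intros (H1 & H2 & H3). split; [exact H1|split; [apply H2|]].
    rewrite <- H3. apply measureP. exact H2.
Qed.

(** * The transition around one precolored vertex *)

(** The geometric sum [1 + r + ... + r^(m-1)] in Horner form, the form in which the recursion for
    [resolved] uses it. *)
Fixpoint geo (r : R) (m : nat) : R :=
  match m with O => 0 | S m' => 1 + r * geo r m' end.

Lemma geo_succ (r : R) (m : nat) : geo r (S m) = geo r m + r ^ m.
Proof.
  induction m as [|m IH]; [simpl; ring|].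
  change (geo r (S (S m))) with (1 + r * geo r (S m)). rewrite IH at 1. cbn [geo pow]. ring.
Qed.

Lemma geo_sum (x : R) (m : nat) :
  geo (x ^ 2) (S m) = sum_f_R0 (fun j => x ^ (2 * j)) m.
Proof.
  induction m as [|m IH]; [simpl; ring|].
  rewrite geo_succ, IH, tech5, pow_mult. reflexivity.
Qed.

Lemma geo_nonneg (r : R) (m : nat) : 0 <= r -> 0 <= geo r m.
Proof. intros Hr. induction m as [|m IH]; simpl; [lra|nra]. Qed.

Lemma geo_le (r : R) (m n : nat) : 0 <= r -> (m <= n)%nat -> geo r m <= geo r n.
Proof.
  intros Hr H. induction H as [|n H IH]; [lra|].
  rewrite geo_succ. pose proof (pow_le r n Hr). lra.
Qed.

(* The fraction of the precolored set on which the layer at distance [2 i] has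
   switched to the base coloring.  It solves [r a(i+1) = a(i) + r - 1 + 1/geo r n]
   with boundary values 0 and 1, and is constantly 1 beyond [n]. *)
Definition resolved (r : R) (n i : nat) : R := 1 - geo r (n - i) / geo r n.

Section Resolved.
Variables (r : R) (n : nat).
Hypotheses (Hr : 0 <= r) (Hn : (0 < n)%nat).

Lemma geo_pos : 0 < geo r n.
Proof.
  destruct n as [|m]; [lia|]. simpl. pose proof (geo_nonneg r m Hr). nra.
Qed.

Lemma resolved_0 : resolved r n 0 = 0.
Proof. unfold resolved. rewrite Nat.sub_0_r. pose proof geo_pos. field. lra. Qed.

Lemma resolved_n : resolved r n n = 1.
Proof. unfold resolved. rewrite Nat.sub_diag. simpl. unfold Rdiv. ring. Qed.

Lemma resolved_mono (i : nat) : resolved r n i <= resolved r n (S i).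
Proof.
  unfold resolved. assert (H : geo r (n - S i) <= geo r (n - i)) by (apply geo_le; [exact Hr|lia]).
  assert (geo r (n - S i) / geo r n <= geo r (n - i) / geo r n); [|lra].
  apply Rmult_le_compat_r; [|exact H]. left. apply Rinv_0_lt_compat, geo_pos.
Qed.

Lemma resolved_01 (i : nat) : 0 <= resolved r n i <= 1.
Proof.
  pose proof geo_pos as Hg. unfold resolved. split.
  - assert (geo r (n - i) / geo r n <= geo r n / geo r n).
    + apply Rmult_le_compat_r; [left; apply Rinv_0_lt_compat, geo_pos|].
      apply geo_le; [exact Hr|lia].
    + replace (geo r n / geo r n) with 1 in H by (field; lra). lra.
  - assert (0 <= geo r (n - i) / geo r n); [|lra].
    apply Rmult_le_pos; [apply geo_nonneg, Hr|left; apply Rinv_0_lt_compat, geo_pos].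
Qed.

(** For [i < n] equality holds, by the Horner recursion of [geo]. For [n <= i] both values of
    [resolved] are 1 and the slack is [/ geo r n]. *)
Lemma resolved_step (i : nat) :
  r * resolved r n (S i) <= resolved r n i + r - 1 + / geo r n.
Proof.
  pose proof geo_pos as Hg. assert (Hi : 0 < / geo r n) by (apply Rinv_0_lt_compat, Hg).
  unfold resolved. destruct (le_lt_dec n i) as [H|H].
  - replace (n - S i)%nat with 0%nat by lia. replace (n - i)%nat with 0%nat by lia.
    simpl. unfold Rdiv. lra.
  - replace (n - i)%nat with (S (n - S i)) by lia. cbn [geo].
    apply Req_le. field. lra.
Qed.
End Resolved.

(* Points of [P] lie in every even layer and no odd layer, and points of [Q] in
   every odd layer and no even one, until they are absorbed by [Pf] or [Qf],
   from where on they follow the set [Y] assigned by the base coloring. *)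
Definition layer_color (P Q : R -> Prop) (Pf Qf : nat -> R -> Prop) (n : nat)
  (Y : R -> Prop) : R -> Prop :=
  let i := Nat.div2 n in
  if Nat.even n then union (diff P (Pf i)) (inter Y (union (Pf i) (Qf i)))
  else union (diff Q (Qf (S i))) (inter Y (union (Qf (S i)) (Pf i))).

Lemma layer_color_even (P Q : R -> Prop) (Pf Qf : nat -> R -> Prop) (i : nat) (Y : R -> Prop) :
  layer_color P Q Pf Qf (2 * i) Y =
  union (diff P (Pf i)) (inter Y (union (Pf i) (Qf i))).
Proof.
  unfold layer_color. rewrite Nat.even_mul. cbn [orb Nat.even].
  rewrite Nat.div2_double. reflexivity.
Qed.

Lemma layer_color_odd (P Q : R -> Prop) (Pf Qf : nat -> R -> Prop) (i : nat) (Y : R -> Prop) :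
  layer_color P Q Pf Qf (S (2 * i)) Y =
  union (diff Q (Qf (S i))) (inter Y (union (Qf (S i)) (Pf i))).
Proof.
  unfold layer_color. rewrite Nat.even_succ, Nat.odd_mul. cbn [andb Nat.odd Nat.even negb].
  rewrite Nat.div2_succ_double. reflexivity.
Qed.

Lemma nat_even_or_odd (n : nat) : exists i, n = (2 * i)%nat \/ n = S (2 * i).
Proof.
  destruct (Nat.Even_or_Odd n) as [[i H]|[i H]]; exists i; lia.
Qed.

(** From layer [2 * i] to the next only the absorbed part of [Q] grows, and from there to layer
    [2 * i + 2] only that of [P]. The newly absorbed points were absent from the layer just left, so
    they cause no conflict; points absorbed before follow the disjoint sets [Y] and [Z]. *)
Lemma layer_color_disjoint (P Q : R -> Prop) (Pf Qf : nat -> R -> Prop) (n : nat)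
  (Y Z : R -> Prop) :
  (forall x, ~ (P x /\ Q x)) ->
  (forall i x, Pf i x -> P x) -> (forall i x, Qf i x -> Q x) ->
  (forall i x, Pf i x -> Pf (S i) x) -> (forall i x, Qf i x -> Qf (S i) x) ->
  (forall x, ~ (Y x /\ Z x)) ->
  forall x, ~ (layer_color P Q Pf Qf n Y x /\ layer_color P Q Pf Qf (S n) Z x).
Proof.
  intros HPQ HP HQ MP MQ HYZ x.
  specialize (HPQ x). specialize (HYZ x).
  destruct (nat_even_or_odd n) as [i [->| ->]].
  - rewrite layer_color_even, layer_color_odd.
    specialize (MP i x). specialize (MQ i x). pose proof (HQ i x). pose proof (HP i x).
    specialize (HQ (S i) x). unfold union, inter, diff. tauto.
  - replace (S (S (2 * i))) with (2 * S i)%nat by lia.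
    rewrite layer_color_even, layer_color_odd.
    specialize (MP i x). specialize (HP (S i) x). specialize (HQ (S i) x).
    unfold union, inter, diff. tauto.
Qed.

(** One formula serves both parities: odd layers are the case with [P] and [Q] exchanged, [Qf (S i)]
    standing for [P'] and [Pf i] for [Q']. *)
Lemma measure_half_layer (P Q P' Q' Y : R -> Prop) :
  bounded_measurable P -> bounded_measurable P' -> bounded_measurable Q' ->
  bounded_measurable Y ->
  (forall x, ~ (P x /\ Q x)) -> (forall x, P' x -> P x) -> (forall x, Q' x -> Q x) ->
  measure (union (diff P P') (inter Y (union P' Q'))) =
  measure P - measure P' + measure (inter Y P') + measure (inter Y Q').
Proof.
  intros bP bP' bQ' bY HPQ HP HQ.
  rewrite measure_union; auto using bm_diff, bm_inter, bm_union.
  - rewrite measure_diff by auto.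
    replace (inter Y (union P' Q')) with (union (inter Y P') (inter Y Q')).
    + rewrite measure_union; auto using bm_inter; [lra|].
      intros x. specialize (HPQ x). specialize (HP x). specialize (HQ x). unfold inter. tauto.
    + apply set_ext. unfold inter, union. tauto.
  - intros x. specialize (HPQ x). specialize (HQ x). unfold inter, union, diff. tauto.
Qed.

(** [col i v] is what [v] may use when it lies at distance [i] from the precolored vertex. Measure
    at least one is enough, since a surplus can be discarded later; in layer [2 * n] the transition
    to the sets [y v] is complete. *)
Lemma layered_coloring_exists (V : Type) (vs : list V) (y : V -> R -> Prop)
  (P : R -> Prop) (k eps : R) (n : nat) :
  (0 < n)%nat -> 2 <= k -> 0 < eps -> 1 <= eps * k * geo ((k - 1) ^ 2) n ->
  (forall v, In v vs) ->
  (forall v, bounded_measurable (y v) /\ (forall x, y v x -> below (k + eps) x)) ->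
  (forall v, measure (y v) * k = k + eps) ->
  unit_color_set (k + eps) P ->
  (forall v, measure (inter (y v) P) * k = 1) ->
  exists col : nat -> V -> R -> Prop,
    (forall i v, bounded_measurable (col i v) /\ (forall x, col i v x -> below (k + eps) x) /\
       1 <= measure (col i v)) /\
    (forall v, col 0%nat v = P) /\
    (forall v x, col (2 * n)%nat v x -> y v x) /\
    (forall i u v, (forall x, ~ (y u x /\ y v x)) ->
       forall x, ~ (col i u x /\ col (S i) v x)).
Proof.
  intros Hn Hk Heps Hgeo Hvs Hy Hy1 HP Hy2.
  apply unit_color_setP in HP. destruct HP as (sP & bP & mP).
  set (Om := below (k + eps)) in *. set (Q := diff Om P).
  assert (bOm : bounded_measurable Om) by apply bm_below.
  assert (bQ : bounded_measurable Q) by (apply bm_diff; assumption).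
  assert (mOm : measure Om = k + eps) by (apply measure_below; lra).
  assert (mQ : measure Q = k - 1 + eps).
  { unfold Q. rewrite measure_diff by assumption. lra. }
  assert (bT : forall C, In C (map y vs) -> bounded_measurable C).
  { intros C HC. apply in_map_iff in HC. destruct HC as [v [<- _]]. apply Hy. }
  assert (inT : forall v, In (y v) (map y vs)) by (intros v; apply in_map, Hvs).
  (* With all the sets [y v] as tests, the measure of a layer set does not depend on the vertex. *)
  destruct (uniform_chain_exists _ P bT bP) as (BP & UP & MP & P0 & P1).
  destruct (uniform_chain_exists _ Q bT bQ) as (BQ & UQ & MQ & Q0 & Q1).
  set (r := (k - 1) ^ 2) in *. assert (Hr : 0 <= r) by (unfold r; nra).
  set (a := resolved r n).
  (* [Q] has measure [k - 1 + eps], so this fraction of it has measure [(k - 1) * a i], the amount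
     that keeps even layers at measure exactly one. *)
  set (b := fun i => (k - 1) * a i / (k - 1 + eps)).
  assert (Ha : forall i, 0 <= a i <= 1) by (intros i; apply resolved_01; assumption).
  assert (Ma : forall i, a i <= a (S i)) by (intros i; apply resolved_mono; assumption).
  assert (Hbe : forall i, b i * (k - 1 + eps) = (k - 1) * a i).
  { intros i. unfold b. field. lra. }
  assert (Hb : forall i, 0 <= b i <= 1).
  { intros i. specialize (Hbe i). specialize (Ha i). split; nra. }
  assert (Mb : forall i, b i <= b (S i)).
  { intros i. pose proof (Hbe i). pose proof (Hbe (S i)). specialize (Ma i). nra. }
  set (Pf := fun i => BP (a i)). set (Qf := fun i => BQ (b i)).
  assert (sPf : forall i x, Pf i x -> P x) by (intros i; apply (UP _ (Ha i))).
  assert (sQf : forall i x, Qf i x -> Q x) by (intros i; apply (UQ _ (Hb i))).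
  assert (bPf : forall i, bounded_measurable (Pf i)) by (intros i; apply (UP _ (Ha i))).
  assert (bQf : forall i, bounded_measurable (Qf i)) by (intros i; apply (UQ _ (Hb i))).
  assert (mPf : forall i, measure (Pf i) = a i).
  { intros i. destruct (UP _ (Ha i)) as (_ & _ & H & _). unfold Pf. rewrite H, mP. ring. }
  assert (mQf : forall i, measure (Qf i) = (k - 1) * a i).
  { intros i. destruct (UQ _ (Hb i)) as (_ & _ & H & _). unfold Qf. rewrite H, mQ. apply Hbe. }
  assert (iPf : forall v i, measure (inter (y v) (Pf i)) * k = a i).
  { intros v i. destruct (UP _ (Ha i)) as (_ & _ & _ & H). specialize (H _ (inT v)).
    replace (inter (y v) (Pf i)) with (inter (Pf i) (y v)) by (apply set_ext; set_tac).
    unfold Pf. rewrite H. replace (inter P (y v)) with (inter (y v) P) by (apply set_ext; set_tac).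
    rewrite Rmult_assoc, Hy2. ring. }
  assert (iQf : forall v i, measure (inter (y v) (Qf i)) * k = (k - 1) * a i).
  { intros v i. destruct (UQ _ (Hb i)) as (_ & _ & _ & H). specialize (H _ (inT v)).
    replace (inter (y v) (Qf i)) with (inter (Qf i) (y v)) by (apply set_ext; set_tac).
    unfold Qf. rewrite H.
    assert (E : measure (inter Q (y v)) * k = k - 1 + eps).
    { destruct (Hy v) as [by_ sy].
      pose proof (measure_split (y v) P by_ bP) as E.
      replace (diff (y v) P) with (inter Q (y v)) in E.
      - specialize (Hy1 v). specialize (Hy2 v). rewrite E in Hy1. lra.
      - apply set_ext. intros x. specialize (sy x). unfold inter, Q, diff. tauto. }
    rewrite Rmult_assoc, E. apply Hbe. }
  assert (dPQ : forall x, ~ (P x /\ Q x)) by (unfold Q, diff; tauto).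
  assert (dQP : forall x, ~ (Q x /\ P x)) by (unfold Q, diff; tauto).
  assert (sQ : forall x, Q x -> Om x) by (unfold Q, diff; tauto).
  assert (Hg : / geo r n <= eps * k).
  { pose proof (geo_pos r n Hr Hn) as Hg.
    apply (Rmult_le_reg_r (geo r n)); [exact Hg|]. rewrite Rinv_l; lra. }
  exists (fun i v => layer_color P Q Pf Qf i (y v)). repeat apply conj.
  - intros i v. destruct (Hy v) as [by_ sy].
    assert (Hsub : forall x, layer_color P Q Pf Qf i (y v) x -> Om x).
    { intros x. specialize (sy x). specialize (sP x). specialize (sQ x).
      unfold layer_color. destruct (Nat.even i); unfold union, inter, diff; tauto. }
    assert (Hbm : bounded_measurable (layer_color P Q Pf Qf i (y v))).
    { unfold layer_color. destruct (Nat.even i); auto 6 using bm_union, bm_inter, bm_diff. }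
    split; [exact Hbm|split; [exact Hsub|]].
    destruct (nat_even_or_odd i) as [j [->| ->]].
    (* The total is [1 - a j + a j / k + (k - 1) * a j / k = 1]. *)
    + rewrite layer_color_even, (measure_half_layer P Q); eauto.
      pose proof (iPf v j). pose proof (iQf v j). rewrite mP, mPf. nra.
    (* Multiplied by [k], the claim becomes [r * a (S j) <= a j + r - 1 + eps * k], which follows
       from [resolved_step] and [Hg]. *)
    + rewrite layer_color_odd, (measure_half_layer Q P); eauto.
      pose proof (iPf v j) as E1. pose proof (iQf v (S j)) as E2. rewrite mQ, mQf.
      pose proof (resolved_step r n Hr Hn j) as E3. fold a in E3.
      apply (Rmult_le_reg_r k); [lra|].
      rewrite !Rmult_plus_distr_r, E1, E2.
      assert (E4 : r = (k - 1) * (k - 1)) by (unfold r; ring). nra.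
  - intros v. change 0%nat with (2 * 0)%nat. rewrite layer_color_even.
    apply set_ext. intros x. unfold Pf, Qf, b, a. rewrite resolved_0 by assumption.
    replace ((k - 1) * 0 / (k - 1 + eps)) with 0 by (unfold Rdiv; ring).
    specialize (P0 x). specialize (Q0 x). unfold union, inter, diff. tauto.
  (* [Pf n] contains all of [P], so no point outside [y v] survives. *)
  - intros v x. rewrite layer_color_even. unfold Pf, Qf, a at 1 2. rewrite resolved_n.
    specialize (P1 x). unfold union, inter, diff. tauto.
  - intros i u v Huv. apply layer_color_disjoint; auto.
    + intros j x. apply MP; [|apply Ha]. split; [apply Ha|apply Ma].
    + intros j x. apply MQ; [|apply Hb]. split; [apply Hb|apply Mb].
Qed.

(** * Walks and distances *)

Section Walks.
Variables (V : Type) (adj : V -> V -> Prop).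
Hypothesis adj_sym : forall u v, adj u v -> adj v u.

Lemma walk_app (u v w : V) (m n : nat) :
  walk adj u v m -> walk adj v w n -> walk adj u w (m + n).
Proof.
  intros H1 H2. induction H1 as [v|u x v m Hx _ IH]; [exact H2|].
  simpl. apply walkS with x; auto.
Qed.

Lemma walk_rev (u v : V) (m : nat) : walk adj u v m -> walk adj v u m.
Proof.
  intros H. induction H as [v|u x v m Hx _ IH]; [constructor|].
  replace (S m) with (m + 1)%nat by lia. apply walk_app with x; [exact IH|].
  apply walkS with u; [auto|constructor].
Qed.

Lemma walk_bridge (u v w x : V) (m n : nat) :
  walk adj u w m -> adj u v -> walk adj v x n -> walk adj w x (m + S n).
Proof.
  intros H1 H2 H3. apply walk_app with u; [apply walk_rev; exact H1|].
  apply walkS with v; assumption.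
Qed.

(* Two steps of a walk move a color set of a fractional [k]-coloring by measure
   at most [k - 2]; an odd closed walk must move it off itself. *)
Lemma odd_closed_walk_long (k : R) (c : V -> R -> Prop) (v : V) (l : nat) :
  2 <= k -> fractional_coloring adj k c -> walk adj v v (S (2 * l)) ->
  1 <= INR l * (k - 2).
Proof.
  intros Hk [Hc Hd].
  assert (Hu := fun u => proj1 (unit_color_setP k (c u)) (Hc u)).
  assert (sc : forall u x, c u x -> below k x) by (intros u; apply Hu).
  assert (bc : forall u, bounded_measurable (c u)) by (intros u; apply Hu).
  assert (mc : forall u, measure (c u) = 1) by (intros u; apply Hu).
  (* Even and odd walks are bounded together: prepending an edge turns an overlap bound into a
     difference bound at cost [k - 2], the measure left by two adjacent color sets, and a difference
     bound into an overlap bound at no cost. *)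
  assert (Hwalk : forall u w n, walk adj u w n -> forall j,
    (n = (2 * j)%nat -> measure (diff (c w) (c u)) <= INR j * (k - 2)) /\
    (n = S (2 * j) -> measure (inter (c u) (c w)) <= INR j * (k - 2))).
  { intros u w n H. induction H as [w|u x w n Hux Hxw IH]; intros j; split; intros Hj.
    - replace (diff (c w) (c w)) with empty by (apply set_ext; set_tac).
      rewrite measure_empty. apply Rmult_le_pos; [apply pos_INR|lra].
    - lia.
    - destruct j as [|j]; [lia|]. destruct (IH j) as [_ IHj].
      specialize (IHj ltac:(lia)). rewrite S_INR.
      assert (bR : bounded_measurable (diff (diff (below k) (c u)) (c x))).
      { auto using bm_diff, bm_below. }
      assert (mR : measure (diff (diff (below k) (c u)) (c x)) = k - 2).
      { rewrite measure_diff; auto using bm_diff, bm_below.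
        - rewrite measure_diff by eauto using bm_below.
          rewrite measure_below, !mc by lra. ring.
        - intros z Hz. specialize (Hd u x Hux z). specialize (sc x z). unfold diff. tauto. }
      apply Rle_trans with
        (measure (union (inter (c x) (c w)) (diff (diff (below k) (c u)) (c x)))).
      + apply measure_subset; auto using bm_diff, bm_inter, bm_union.
        intros z. specialize (sc w z). unfold diff, union, inter.
        destruct (classic (c x z)); tauto.
      + refine (Rle_trans _ _ _ (measure_subadd _ _ _ bR) _);
          [auto using bm_inter|]. rewrite mR. lra.
    - destruct (IH j) as [IHj _]. specialize (IHj ltac:(lia)).
      refine (Rle_trans _ _ _ _ IHj).
      apply measure_subset; auto using bm_diff, bm_inter.
      intros z. specialize (Hd u x Hux z). unfold diff, inter. tauto. }
  intros H. destruct (Hwalk v v _ H l) as [_ Hl]. specialize (Hl eq_refl).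
  replace (inter (c v) (c v)) with (c v) in Hl by (apply set_ext; set_tac).
  rewrite mc in Hl. exact Hl.
Qed.

Definition nearest (W : V -> Prop) (v w : V) (n : nat) : Prop :=
  W w /\ walk adj v w n /\ forall w' n', W w' -> walk adj v w' n' -> (n <= n')%nat.

(** [None] stands for distance greater than [D] from [W], which includes vertices that no walk joins
    to [W]. *)
Lemma nearest_or_far (W : V -> Prop) (v : V) (D : nat) :
  exists o : option (V * nat),
    match o with
    | Some (w, n) => nearest W v w n /\ (n <= D)%nat
    | None => forall w n, W w -> walk adj v w n -> (D < n)%nat
    end.
Proof.
  destruct (classic (exists n, (n <= D)%nat /\ exists w, W w /\ walk adj v w n))
    as [[n [Hn Hw]]|Hno].
  - destruct (Wf_nat.dec_inh_nat_subset_has_unique_least_element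
                (fun n => exists w, W w /\ walk adj v w n)) as (m & [[w [Hw1 Hw2]] Hm] & _).
    + intros j. apply classic.
    + eauto.
    + exists (Some (w, m)). split; [split; [exact Hw1|split; [exact Hw2|eauto]]|].
      specialize (Hm n Hw). lia.
  - exists None. intros w n Hw Hv. apply Nat.nle_gt. intros Hle. apply Hno. eauto.
Qed.
End Walks.

(** * Assembling the colorings *)

(** The theorem in the parameters of the construction: [n] is the [d'] of the statement, [d] is
    [4 * n + 1], the upper bound on [k] is cleared of its denominator, and the sum is written with
    [geo]. *)
Lemma precoloring_extends_real (n : nat) (k eps : R) (V : Type) (adj : V -> V -> Prop)
  (W : V -> Prop) (p : V -> R -> Prop) :
  (0 < n)%nat -> 2 <= k -> 0 < eps -> INR (2 * n - 1) * (k - 2) < 1 ->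
  1 <= eps * k * geo ((k - 1) ^ 2) n ->
  finite_simple_graph adj -> fractionally_colorable adj k ->
  pairwise_distance_at_least adj W (4 * n + 1) ->
  fractional_precoloring W (k + eps) p ->
  precoloring_extends adj W (k + eps) p.
Proof.
  intros Hn Hk Heps Hkn Hgeo [[vs Hvs] [Hsym Hirr]] [c Hcol] Hdist Hp.
  destruct Hcol as [Hc Hcd].
  assert (Hcu : forall v, (forall x, c v x -> below k x) /\
                bounded_measurable (c v) /\ measure (c v) = 1).
  { intros v. apply unit_color_setP, Hc. }
  set (Om := below (k + eps)).
  assert (bOm : bounded_measurable Om) by apply bm_below.
  assert (mOm : measure Om = k + eps) by (apply measure_below; lra).
  (* The precoloring is made total by bounded measurable sets, so that it can be mapped over the
     list of all vertices to give tests. *)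
  destruct (functional_choice (fun v (C : R -> Prop) => bounded_measurable C /\ (W v -> C = p v)))
    as [p' Hp'].
  { intros v. destruct (classic (W v)) as [Hv|Hv].
    - exists (p v). split; [|auto]. apply (unit_color_setP (k + eps)), Hp, Hv.
    - exists empty. split; [apply bm_empty|tauto]. }
  (* [Om] itself is among the tests, and its proportion yields the total measure of each [y v]. *)
  destruct (transport_exists V c (Om :: map p' vs)) with (vs := vs) (D := below k) (A := Om)
    as (y & Hy & Hyd); auto using bm_below.
  { intros v. apply Hcu. }
  { intros C [<-|HC]; [exact bOm|]. apply in_map_iff in HC.
    destruct HC as [v [<- _]]. apply Hp'. }
  rewrite measure_below in Hy by lra.
  assert (Ec : forall v, measure (inter (below k) (c v)) = 1).
  { intros v. destruct (Hcu v) as (s & _ & m). rewrite <- m. f_equal.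
    apply set_ext. intros x. specialize (s x). unfold inter. tauto. }
  assert (by_ : forall v, bounded_measurable (y v)) by (intros v; apply Hy, Hvs).
  assert (sy : forall v x, y v x -> Om x) by (intros v; apply Hy, Hvs).
  assert (my : forall v, measure (y v) * k = k + eps).
  { intros v. destruct (Hy v (Hvs v)) as (_ & s & H). specialize (H Om (or_introl eq_refl)).
    rewrite Ec in H. replace (inter (y v) Om) with (y v) in H.
    - replace (inter Om Om) with Om in H by (apply set_ext; set_tac). lra.
    - apply set_ext. intros x. specialize (s x). unfold inter. tauto. }
  assert (myp : forall w, W w -> forall v, measure (inter (y v) (p w)) * k = 1).
  { intros w Hw v. destruct (Hy v (Hvs v)) as (_ & _ & H).
    destruct (Hp' w) as [_ Ew]. rewrite <- (Ew Hw).
    rewrite (H (p' w)) by (right; apply in_map, Hvs). rewrite Ec, (Ew Hw).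
    destruct (proj1 (unit_color_setP _ _) (Hp w Hw)) as (s & _ & m).
    replace (inter Om (p w)) with (p w); [lra|].
    apply set_ext. intros x. specialize (s x). unfold inter, Om. tauto. }
  assert (dy : forall u v, adj u v -> forall x, ~ (y u x /\ y v x)).
  { intros u v Huv. apply Hyd; auto. intros x [_ Hx]. exact (Hcd u v Huv x Hx). }
  destruct (functional_choice (fun w (col : nat -> V -> R -> Prop) => W w ->
    (forall i v, bounded_measurable (col i v) /\ (forall x, col i v x -> Om x) /\
       1 <= measure (col i v)) /\
    (forall v, col 0%nat v = p w) /\
    (forall v x, col (2 * n)%nat v x -> y v x) /\
    (forall i u v, (forall x, ~ (y u x /\ y v x)) ->
       forall x, ~ (col i u x /\ col (S i) v x)))) as [col Hcl].
  { intros w. destruct (classic (W w)) as [Hw|Hw].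
    - destruct (layered_coloring_exists V vs y (p w) k eps n) as [cl Hcl]; auto.
      { intros v. split; [apply by_|apply sy]. }
      exists cl. intros _. exact Hcl.
    - exists (fun _ _ => empty). tauto. }
  destruct (functional_choice _ (fun v => nearest_or_far V adj W v (2 * n))) as [o Ho].
  (* These sets may have measure above one. They are trimmed at the end, which cannot spoil
     disjointness. *)
  set (full := fun v => match o v with Some (w, i) => col w i v | None => y v end).
  assert (Hfull : forall v, bounded_measurable (full v) /\ (forall x, full v x -> Om x) /\
                            1 <= measure (full v)).
  { intros v. unfold full. specialize (Ho v). destruct (o v) as [[w i]|].
    - destruct Ho as [[Hw _] _]. apply (Hcl w Hw).
    - split; [apply by_|split; [apply sy|]]. specialize (my v). nra. }
  assert (HW : forall v, W v -> full v = p v).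
  { intros v Hv. unfold full. specialize (Ho v). destruct (o v) as [[w i]|].
    - destruct Ho as [(Hw & Hwk & Hmin) _].
      assert (Hi : (i <= 0)%nat) by (apply (Hmin v); [exact Hv|constructor]).
      assert (i = 0%nat) by lia. subst i. inversion Hwk; subst. apply (Hcl w Hw).
    - specialize (Ho v 0%nat Hv (walk0 adj v)). lia. }
  assert (Hbase : forall u v, (forall x, full u x -> y u x) -> (forall x, full v x -> y v x) ->
                  adj u v -> forall x, ~ (full u x /\ full v x)).
  { intros u v Hu Hv Huv x [H1 H2]. exact (dy u v Huv x (conj (Hu x H1) (Hv x H2))). }
  assert (Hlay : forall u v w i w' j, adj u v -> o u = Some (w, i) -> o v = Some (w', j) ->
                 (i <= j)%nat -> forall x, ~ (full u x /\ full v x)).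
  { intros u v w i w' j Huv Eu Ev Hij.
    pose proof (Ho u) as Hou. pose proof (Ho v) as Hov. rewrite Eu in Hou. rewrite Ev in Hov.
    destruct Hou as [(Hw & Hwk & Hmin) Hi]. destruct Hov as [(Hw' & Hwk' & Hmin') Hj].
    pose proof (walk_bridge V adj Hsym u v w w' i j Hwk Huv Hwk') as Hbr.
    assert (Eu' : full u = col w i u) by (unfold full; rewrite Eu; reflexivity).
    assert (Ev' : full v = col w' j v) by (unfold full; rewrite Ev; reflexivity).
    (* In layer [2 * n] both vertices use only base colors, so they may belong to different vertices
       of [W]. *)
    destruct (Nat.eq_dec i (2 * n)) as [Ei|Ni].
    { assert (j = (2 * n)%nat) by lia. subst i j. apply Hbase; [| |exact Huv].
      - rewrite Eu'. apply (Hcl w Hw).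
      - rewrite Ev'. apply (Hcl w' Hw'). }
    (* Now [i <= 2 * n - 1] and [j <= 2 * n], so the walk from [w] to [w'] has length
       [i + S j <= 4 * n], one short of the required distance. *)
    assert (Hww : w = w').
    { apply NNPP. intros Hne. specialize (Hdist w w' Hw Hw' Hne _ Hbr). lia. }
    subst w'.
    assert (Hji : (j <= S i)%nat).
    { apply (Hmin' w); [exact Hw|]. apply walkS with u; auto. }
    destruct (Nat.eq_dec j (S i)) as [->|Nj].
    { rewrite Eu', Ev'. apply (Hcl w Hw). apply dy, Huv. }
    (* An edge inside one layer closes an odd walk of length [2 * i + 1] with [i <= 2 * n - 1],
       against the upper bound on [k]. *)
    exfalso. assert (j = i) by lia. subst j.
    replace (i + S i)%nat with (S (2 * i)) in Hbr by lia.
    pose proof (odd_closed_walk_long V adj k c w i Hk (conj Hc Hcd) Hbr) as H1.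
    assert (INR i <= INR (2 * n - 1)) by (apply le_INR; lia). nra. }
  assert (Hdisj : forall u v, adj u v -> forall x, ~ (full u x /\ full v x)).
  { assert (Hfar : forall u v w i, adj u v -> o u = Some (w, i) -> o v = None ->
                   forall x, ~ (full u x /\ full v x)).
    { intros u v w i Huv Eu Ev.
      pose proof (Ho u) as Hou. pose proof (Ho v) as Hov. rewrite Eu in Hou. rewrite Ev in Hov.
      destruct Hou as [(Hw & Hwk & _) Hi].
      (* A neighbor farther than [2 * n] from [W] forces [u] into layer [2 * n], where only base
         colors occur. *)
      specialize (Hov w (S i) Hw (walkS (Hsym _ _ Huv) Hwk)).
      assert (i = (2 * n)%nat) by lia. subst i.
      apply Hbase; [| |exact Huv].
      - unfold full. rewrite Eu. apply (Hcl w Hw).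
      - unfold full. rewrite Ev. auto. }
    intros u v Huv x Hx.
    destruct (o u) as [[w i]|] eqn:Eu; destruct (o v) as [[w' j]|] eqn:Ev.
    - destruct (Nat.le_ge_cases i j) as [Hij|Hij].
      + exact (Hlay u v w i w' j Huv Eu Ev Hij x Hx).
      + apply (Hlay v u w' j w i (Hsym _ _ Huv) Ev Eu Hij x). tauto.
    - exact (Hfar u v w i Huv Eu Ev x Hx).
    - apply (Hfar v u w' j (Hsym _ _ Huv) Ev Eu x). tauto.
    - revert x Hx. apply Hbase; [| |exact Huv]; unfold full; [rewrite Eu|rewrite Ev]; auto. }
  (* Outside [W] the sets are trimmed to measure one; on [W] they already equal the precoloring and
     are kept. *)
  destruct (functional_choice (fun v (C : R -> Prop) =>
    unit_color_set (k + eps) C /\ (forall x, C x -> full v x) /\ (W v -> C = p v)))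
    as [c' Hc'].
  { intros v. destruct (classic (W v)) as [Hv|Hv].
    - exists (p v). split; [apply Hp, Hv|]. rewrite (HW v Hv). auto.
    - destruct (Hfull v) as (bf & sf & mf).
      destruct (subset_of_measure (full v) 1 bf) as (B & bB & sB & mB); [lra|].
      exists B. split; [|split; [exact sB|tauto]].
      apply unit_color_setP. split; [intros x Hx; apply sf, sB, Hx|split; assumption]. }
  exists c'. split; [split|].
  - intros v. apply Hc'.
  - intros u v Huv x [H1 H2]. apply (Hdisj u v Huv x).
    split; [apply (Hc' u)|apply (Hc' v)]; assumption.
  - intros v Hv x. destruct (Hc' v) as (_ & _ & E). rewrite (E Hv). tauto.
Qed.

Theorem mainTheorem16 (d : nat) (k : Q) (eps : R) :
  (5 <= d)%nat -> (d mod 4 = 1)%nat -> 0 < eps ->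
  2 <= Q2R k ->
  Q2R k < 2 + 1 / INR (2 * (d / 4) - 1) ->
  eps * Q2R k * sum_f_R0 (fun j => (Q2R k - 1) ^ (2 * j)) (d / 4 - 1) >= 1 ->
  forall (V : Type) (adj : V -> V -> Prop) (W : V -> Prop) (p : V -> R -> Prop),
    finite_simple_graph adj ->
    fractionally_colorable adj (Q2R k) ->
    pairwise_distance_at_least adj W d ->
    fractional_precoloring W (Q2R k + eps) p ->
    precoloring_extends adj W (Q2R k + eps) p.
Proof.
  intros Hd Hmod Heps Hk Hk' Hsum V adj W p HG Hc HW Hp.
  pose proof (Nat.div_mod_eq d 4) as Ed. rewrite Hmod in Ed.
  set (n := (d / 4)%nat) in *. assert (Hn : (0 < n)%nat) by lia.
  apply (precoloring_extends_real n); auto.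
  - assert (Hpos : 0 < INR (2 * n - 1)) by (apply lt_0_INR; lia).
    replace 1 with (INR (2 * n - 1) * (1 / INR (2 * n - 1))) by (field; lra).
    apply Rmult_lt_compat_l; lra.
  (* [sum_f_R0] up to [n - 1] has [n] terms, hence the shift in the argument of [geo]. *)
  - replace n with (S (n - 1)) by lia. rewrite geo_sum. lra.
  - rewrite <- Ed. exact HW.
Qed.
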